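(* Let $\tau$ be the Takagi function and let $\Gamma_H^{abs}$ be the set of abscissas $x\in[0,1]$ such that the level set $L(\tau(x))$ has positive Hausdorff dimension, i.e. $$\Gamma_H^{abs}:=\{x\in[0,1]:\ \dim_H(L(\tau(x)))>0\}.$$ Then $\Gamma_H^{abs}$ has full Hausdorff dimension, i.e. $\dim_H(\Gamma_H^{abs})=1$.
   Context: The Takagi function is $\tau(x)=\sum_{n=0}^\infty \frac{\ll 2^n x\gg}{2^n}$ for $x\in[0,1]$, where $\ll t\gg$ denotes the distance from $t$ to the nearest integer. It satisfies $0\le\tau(x)\le\frac23$. For $0\le y\le\frac23$ the level set is $L(y)=\{x\in[0,1]:\tau(x)=y\}$. $\dim_H$ denotes Hausdorff dimension of subsets of $\mathbb{R}$. *)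

(* Defs.v *)
From HB Require Import structures.
From mathcomp Require Import all_boot all_order all_algebra.
From mathcomp Require Import all_classical all_reals all_analysis.

Set Implicit Arguments.
Unset Strict Implicit.
Unset Printing Implicit Defensive.

Import Order.TTheory GRing.Theory Num.Theory.
Import numFieldNormedType.Exports.

Local Open Scope classical_set_scope.
Local Open Scope ring_scope.

Section Takagi.
Context {R : realType}.

Definition dist_int (t : R) : R := inf [set `|t - k%:~R| | k in [set: int]].

(* The series converges for every real x (its terms are at most 2^-n), so
   limn is its genuine sum. *)
Definition takagi (x : R) : R :=
  limn (series (fun n => dist_int (2 ^+ n * x) / 2 ^+ n)).

Definition takagi_level (y : R) : set R :=
  [set x | x \in `[0, 1] /\ takagi x = y].

End Takagi.

Section HausdorffDimension.
Context {R : realType}.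
Local Open Scope ereal_scope.

(* The added element 0 only matters for U = set0, whose diameter is thus 0. *)
Definition diam (U : set R) : \bar R :=
  ereal_sup (0 |` [set (`|u.1 - u.2|%R)%:E | u in U `*` U]).

(* The empty set is treated apart since 0 `^ 0 = 1: the empty set must have
   weight 0 and a singleton weight 1 when s = 0. *)
Definition diam_pow (s : R) (U : set R) : \bar R :=
  if U == set0 then 0 else diam U `^ s.

Definition hausdorff_premeasure (s delta : R) (A : set R) : \bar R :=
  ereal_inf [set \sum_(0 <= k <oo) diam_pow s (F k) |
             F in [set F : nat -> set R |
               (forall k, diam (F k) <= delta%:E) /\ A `<=` \bigcup_k F k]].

Definition hausdorff_measure (s : R) (A : set R) : \bar R :=
  ereal_sup [set hausdorff_premeasure s delta A |
             delta in [set delta : R | (0 < delta)%R]].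

Definition hausdorff_dim (A : set R) : \bar R :=
  ereal_inf [set s%:E |
             s in [set s : R | (0 <= s)%R /\ hausdorff_measure s A = 0]].

End HausdorffDimension.

Definition Gamma_H_abs (R : realType) : set R :=
  [set x | x \in `[0, 1] /\ (0 < hausdorff_dim (takagi_level (takagi x)))%E].

Arguments Gamma_H_abs R : clear implicits.

(* Main.v *)
(* Fix m and cut the binary expansion of x into blocks of length 2m, each
   containing m zeros and m ones. On a dyadic interval given by such a block
   the partial sum of the first 2m terms of the Takagi series is constant, so
   that takagi ((d + t) / 4^m) = c + takagi t / 4^m with c depending only on
   the block d, and complementing every bit of the block does not change c.
   Hence the level set of x contains all the points obtained by complementing
   an arbitrary set of blocks, a Cantor set of dimension at least 1 / (2m).
   The set of all such x is itself a Cantor set with 'C(2m, m) choices per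
   block, so its dimension is at least log 'C(2m, m) / (2m log 2), which tends
   to 1 with m.
   Dimensions of these Cantor sets are bounded below by recoding the points
   with n choices per block in base n: this map onto [0, 1] is s-Hoelder for
   (4^m)^s <= n, because the digits 0 and 4^m - 1 never occur, so a cover of
   the Cantor set yields a cover of [0, 1] and Lebesgue measure is
   countably subadditive. *)
Require Import Defs.
From mathcomp Require Import all_boot all_order all_algebra.
From mathcomp Require Import all_classical all_reals all_analysis.
From mathcomp Require Import ring lra zify.

Set Implicit Arguments.
Unset Strict Implicit.
Unset Printing Implicit Defensive.

Import Order.TTheory GRing.Theory Num.Theory.
Import numFieldNormedType.Exports.

Local Open Scope classical_set_scope.
Local Open Scope ring_scope.

(** * Limits of series: geometric bounds, removal of the first term, scaling *)

Lemma is_cvg_series_geometric_bound (R : realType) (u : R^nat) (M q : R) :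
  0 <= q < 1 -> (forall n, 0 <= u n <= M * q ^+ n) -> cvgn (series u).
Proof.
move=> /andP[q0 q1] uM.
have cg : cvgn (series (geometric M q)).
  by apply: is_cvg_geometric_series; rewrite ger0_norm.
apply: (series_le_cvg _ _ _ cg) => n; have /andP[u0 uMn] := uM n => //.
exact: le_trans u0 uMn.
Qed.

Lemma limn_series_ge0 (R : realType) (u : R^nat) :
  cvgn (series u) -> (forall n, 0 <= u n) -> 0 <= limn (series u).
Proof. by move=> cu u0; apply: limr_ge => //; near=> n; exact: sumr_ge0.
Unshelve. all: by end_near. Qed.

Lemma limn_series_le_geometric (R : realType) (u : R^nat) (M q : R) :
  0 <= q < 1 -> (forall n, 0 <= u n <= M * q ^+ n) ->
  limn (series u) <= M / (1 - q).
Proof.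
move=> q01 uM; have cu := is_cvg_series_geometric_bound q01 uM.
have q1 : `|q| < 1 by case/andP: q01 => q0 q1; rewrite ger0_norm.
have cg := @cvg_geometric_series _ M q q1.
rewrite -(cvg_lim _ cg)//; apply: lim_series_le => //; first exact: cvgP cg.
by move=> n; case/andP: (uM n).
Qed.

Lemma limn_series_recl (R : realType) (u : R^nat) :
  cvgn (series u) -> limn (series u) = u 0%N + limn (series (fun n => u n.+1)).
Proof.
move=> cu.
have E n : series u n.+1 = u 0%N + series (fun n => u n.+1) n.
  by rewrite /series/= big_nat_recl.
have c1 : [sequence series u n.+1]_n @ \oo --> limn (series u).
  by rewrite cvg_shiftS.
have c2 : series (fun n => u n.+1) @ \oo --> limn (series u) - u 0%N.
  have -> : series (fun n => u n.+1) = (fun n => series u n.+1 - u 0%N).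
    by apply/funext => n; rewrite E addrC addKr.
  by apply: cvgB => //; exact: cvg_cst.
by rewrite (cvg_lim _ c2)// addrC subrK.
Qed.

Lemma limn_seriesZ (R : realType) (k : R) (u : R^nat) :
  cvgn (series u) -> limn (series (fun n => u n * k)) = limn (series u) * k.
Proof.
move=> cu; apply: cvg_lim => //.
have -> : series (fun n => u n * k) = (fun n => series u n * k).
  by apply/funext => n; rewrite /series/= big_distrl.
by apply: cvgM => //; exact: cvg_cst.
Qed.

(** * Expansions in base [b] *)

Definition expansion {R : realType} (b : nat) (d : nat -> nat) : R :=
  limn (series ((fun i => (d i)%:R / b%:R ^+ i.+1) : R^nat)).

Lemma expansion_term_bound (R : realType) (b : nat) (d : nat -> nat) :
  (1 < b)%N -> (forall i, (d i < b)%N) -> forall i,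
  0 <= ((d i)%:R / b%:R ^+ i.+1 : R) <= (1 - b%:R^-1) * b%:R^-1 ^+ i.
Proof.
move=> b1 db i; have b0 : 0 < b%:R :> R by rewrite ltr0n; lia.
rewrite divr_ge0 ?exprn_ge0//= exprS exprVn invfM mulrA.
rewrite ler_wpM2r ?invr_ge0 ?exprn_ge0//.
rewrite ler_pdivrMr// mulrBl mul1r mulVf ?gt_eqF//.
by rewrite lerBrDr natr1 ler_nat.
Qed.

Lemma invn_itv (R : realType) (b : nat) : (1 < b)%N -> 0 <= (b%:R^-1 : R) < 1.
Proof. by move=> b1; rewrite invr_ge0 ler0n/= invf_lt1 ?ltr1n// ltr0n; lia. Qed.

Lemma is_cvg_expansion (R : realType) (b : nat) (d : nat -> nat) :
  (1 < b)%N -> (forall i, (d i < b)%N) ->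
  cvgn (series ((fun i => (d i)%:R / b%:R ^+ i.+1) : R^nat)).
Proof.
move=> b1 db; apply: is_cvg_series_geometric_bound (invn_itv R b1) _.
exact: expansion_term_bound.
Qed.

Lemma expansion_itv (R : realType) (b : nat) (d : nat -> nat) :
  (1 < b)%N -> (forall i, (d i < b)%N) -> 0 <= (expansion b d : R) <= 1.
Proof.
move=> b1 db; have q01 := invn_itv R b1; apply/andP; split.
  apply: limn_series_ge0 => [|i]; first exact: is_cvg_expansion.
  by case/andP: (@expansion_term_bound R _ _ b1 db i).
apply: (le_trans (limn_series_le_geometric q01 (expansion_term_bound R b1 db))).
by rewrite divff// subr_eq0 gt_eqF//; case/andP: q01.
Qed.

Lemma expansion_recl (R : realType) (b : nat) (d : nat -> nat) :
  (1 < b)%N -> (forall i, (d i < b)%N) ->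
  expansion b d = ((d 0%N)%:R + expansion b (fun i => d i.+1)) / b%:R :> R.
Proof.
move=> b1 db; rewrite {1}/expansion limn_series_recl; last exact: is_cvg_expansion.
rewrite expr1 mulrDl; congr (_ + _); rewrite -limn_seriesZ.
  by congr (limn (series _)); apply/funext => i; rewrite -mulrA -invfM -exprSr.
exact: is_cvg_expansion.
Qed.

(** A shared first digit cancels and leaves the difference of the tails divided by [b]; once no
    shared digit is left, both values lie in [0, 1]. *)
Lemma expansion_agree (R : realType) (b j : nat) (d d' : nat -> nat) :
  (1 < b)%N -> (forall i, (d i < b)%N) -> (forall i, (d' i < b)%N) ->
  (forall i, (i < j)%N -> d i = d' i) ->
  `|expansion b d - expansion b d' : R| <= b%:R^-1 ^+ j.
Proof.
move=> b1; elim: j d d' => [|j IH] d d' db db' dd'.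
  have /andP[? ?] := @expansion_itv R _ _ b1 db.
  have /andP[? ?] := @expansion_itv R _ _ b1 db'.
  by rewrite expr0 ler_norml; lra.
rewrite (expansion_recl R b1 db) (expansion_recl R b1 db') dd'// -mulrBl.
rewrite opprD addrACA subrr add0r normrM exprSr.
have /andP[b0 _] := invn_itv R b1.
by rewrite (ger0_norm b0) ler_wpM2r// IH// => i ij; apply: dd'.
Qed.

(* Digits in [1, b - 2] keep expansions away from the end points of b-adic
   intervals, so that close points share their first digits. *)
Lemma expansion_separated (R : realType) (b j : nat) (d d' : nat -> nat) :
  (1 < b)%N ->
  (forall i, (0 < d i < b.-1)%N) -> (forall i, (0 < d' i < b.-1)%N) ->
  `|expansion b d - expansion b d' : R| < b%:R^-1 ^+ j.+1 ->
  forall i, (i < j)%N -> d i = d' i.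
Proof.
move=> b1; elim: j d d' => // j IH d d' db db'.
have lt_b (f : nat -> nat) : (forall i, (0 < f i < b.-1)%N) ->
    forall i, (f i < b)%N.
  by move=> fb i; move: (fb i); lia.
have b0 : 0 < b%:R :> R by rewrite ltr0n; lia.
have inner (f : nat -> nat) : (forall i, (0 < f i < b.-1)%N) ->
    b%:R^-1 <= (expansion b f : R) <= 1 - b%:R^-1.
  move=> fb; have fb' := lt_b _ fb.
  have /andP[? ?] := @expansion_itv R b (fun i => f i.+1) b1 (fun i => fb' i.+1).
  have -> : 1 - b%:R^-1 = (b%:R - 1) / b%:R :> R.
    by rewrite mulrBl mul1r divff ?gt_eqF.
  rewrite expansion_recl// -{1}[b%:R^-1]mul1r !ler_pM2r ?invr_gt0//.
  have /andP[f1 f2] := fb 0%N.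
  have : (f 0%N).+2%:R <= b%:R :> R by rewrite ler_nat; lia.
  have : 1 <= (f 0%N)%:R :> R by rewrite ler1n.
  by rewrite -addn2 natrD; lra.
have /andP[? ?] := inner _ (fun i => db i.+1).
have /andP[? ?] := inner _ (fun i => db' i.+1).
rewrite (expansion_recl R b1 (lt_b _ db)) (expansion_recl R b1 (lt_b _ db')).
rewrite -mulrBl normrM (gtr0_norm (_ : 0 < b%:R^-1)) ?invr_gt0// exprSr.
rewrite ltr_pM2r ?invr_gt0// => close.
(* By [inner] the tails differ by at most 1 - 2/b, while the sums of digit and tail differ by less
   than 1/b. So the first digits, being integers, differ by less than 1. *)
have d0 : d 0%N = d' 0%N.
  have bj : b%:R^-1 ^+ j.+1 <= b%:R^-1 :> R.
    have /andP[? ?] := invn_itv R b1.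
    by rewrite exprS ler_piMr// exprn_ile1// ltW.
  have := lt_le_trans close bj; rewrite ltr_norml => /andP[? ?].
  by apply/eqP; rewrite eqn_leq; apply/andP; split;
    rewrite -ltnS -(ltr_nat R) -natr1; lra.
case=> // i ij; apply: (IH (fun i => d i.+1) (fun i => d' i.+1)) => //.
by move: close; rewrite d0 opprD addrACA subrr add0r.
Qed.

Lemma expansion_surj (R : realType) (b : nat) (y : R) :
  (1 < b)%N -> 0 <= y < 1 ->
  exists2 d : nat -> nat, (forall i, (d i < b)%N) & expansion b d = y.
Proof.
move=> b1 y01; have b0 : 0 < b%:R :> R by rewrite ltr0n; lia.
(* [T] sends z to the fractional part of b z; the digits are the integer parts met along its
   orbit. *)
pose T (z : R) := b%:R * z - (Num.truncn (b%:R * z))%:R.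
have T01 z : 0 <= z < 1 -> 0 <= T z < 1.
  move=> /andP[z0 z1].
  have /Num.Theory.truncn_itv/andP[] : 0 <= b%:R * z by rewrite mulr_ge0// ltW.
  by rewrite /T -natr1; lra.
pose d (z : R) i := Num.truncn (b%:R * iter i T z).
have iT01 z i : 0 <= z < 1 -> 0 <= iter i T z < 1.
  by move=> z01; elim: i => // i IH; rewrite iterS; exact: T01.
have db z : 0 <= z < 1 -> forall i, (d z i < b)%N.
  move=> z01 i; have /andP[z0 z1] := iT01 z i z01.
  rewrite -(ltr_nat R); apply: le_lt_trans (_ : b%:R * iter i T z < _).
    by rewrite Num.Theory.truncn_le mulr_ge0// ltW.
  by rewrite gtr_pMr.
exists (d y); first exact: db.
(* The claim covers all z because the induction passes from z to [T z]. *)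
have approx n : forall z, 0 <= z < 1 -> `|expansion b (d z) - z| <= b%:R^-1 ^+ n.
  elim: n => [|n IH] z z01.
    have /andP[? ?] := @expansion_itv R _ _ b1 (db z z01).
    by rewrite expr0 ler_norml; lra.
  have -> : expansion b (d z) - z = (expansion b (d (T z)) - T z) / b%:R.
    rewrite expansion_recl//; last exact: db.
    have -> : (fun i => d z i.+1) = d (T z) by apply/funext => i; rewrite /d iterSr.
    by rewrite /T /d/=; field; rewrite gt_eqF.
  rewrite normrM (gtr0_norm (_ : 0 < b%:R^-1)) ?invr_gt0// exprSr.
  by rewrite ler_pM2r ?invr_gt0//; exact/IH/T01.
apply/eqP; rewrite -subr_eq0 -normr_le0.
have /andP[q0 q1] := invn_itv R b1.
have cq : (b%:R^-1 : R) ^+ n @[n --> \oo] --> (0 : R).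
  by apply: cvg_expr; rewrite ger0_norm.
rewrite -(cvg_lim _ cq)//; apply: limr_ge; first exact: cvgP cq.
by near=> n; exact: approx.
Unshelve. all: by end_near. Qed.

(** * Recoding of covers in base [n] and positivity of Hausdorff measure *)

Lemma diam_ge0 (R : realType) (U : set R) : (0 <= diam U)%E.
Proof. by apply: ereal_sup_ubound; left. Qed.

Lemma le_diam (R : realType) (U : set R) (x y : R) :
  U x -> U y -> (`|x - y|%:E <= diam U)%E.
Proof. by move=> Ux Uy; apply: ereal_sup_ubound; right; exists (x, y). Qed.

Lemma diam_pow_ge0 (R : realType) (s : R) (U : set R) : (0 <= diam_pow s U)%E.
Proof. by rewrite /diam_pow; case: ifP => // _; exact: poweR_ge0. Qed.

(* [pr] is the centre and the radius of an interval containing the base n codes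
   of the points of [F]. *)
Lemma expansion_cover (R : realType) (b n : nat) (dig : nat -> 'I_n -> nat)
    (s : R) (F : set R) :
  (1 < n)%N -> (forall i, injective (dig i)) ->
  (forall i c, (0 < dig i c < b.-1)%N) -> 0 <= s -> b%:R `^ s <= n%:R ->
  (diam F <= (b%:R^-1 ^+ 2)%:E)%E ->
  exists pr : R * R, [/\ 0 <= pr.2,
    forall a : nat -> 'I_n, F (expansion b (fun i => dig i (a i))) ->
      `|expansion n (fun i => a i) - pr.1| <= pr.2 &
    (pr.2%:E <= (n%:R ^+ 2)%:E * diam_pow s F)%E].
Proof.
move=> n1 dinj db s0 bs dF.
have b1 : (1 < b)%N by have := db 0%N (Ordinal (ltnW n1)); lia.
have b0 : 0 < b%:R :> R by rewrite ltr0n; lia.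
have n0 : 0 < n%:R :> R by rewrite ltr0n; lia.
have N0 : (0 <= (n%:R ^+ 2 : R)%:E)%E by rewrite lee_fin exprn_ge0.
have [[a0 Fa0]|noa] := pselect (exists a : nat -> 'I_n,
    F (expansion b (fun i => dig i (a i)))); last first.
  exists (0, 0); split => //= [a Fa|]; first by case: noa; exists a.
  by rewrite mule_ge0// diam_pow_ge0.
have Fn0 : F != set0 by apply/set0P; eexists; exact: Fa0.
have dfin : diam F \is a fin_num.
  by rewrite ge0_fin_numE ?diam_ge0// (le_lt_trans dF)// ltry.
have := diam_ge0 F; rewrite /diam_pow (negbTE Fn0).
have dFa a : F (expansion b (fun i => dig i (a i))) ->
    `|expansion b (fun i => dig i (a i)) - expansion b (fun i => dig i (a0 i))|
    <= fine (diam F).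
  by move=> Fa; rewrite -lee_fin fineK//; exact: le_diam.
have agree j (a : nat -> 'I_n) : F (expansion b (fun i => dig i (a i))) ->
    fine (diam F) < b%:R^-1 ^+ j.+1 -> forall i, (i < j)%N -> a i = a0 i.
  move=> Fa dj i ij; apply: (dinj i).
  apply: (@expansion_separated R b j (fun i => dig i (a i))
    (fun i => dig i (a0 i))) => //.
  exact: le_lt_trans (dFa _ Fa) dj.
move: dF dFa agree; rewrite -(fineK dfin) poweR_EFin /= !lee_fin.
set e := fine _ => eb ea agree; rewrite le_eqVlt => /predU1P[e0|e0].
  (* When the diameter is 0, the coded points of [F] share all their digits, so radius 0
     suffices. *)
  exists (expansion n (fun i => a0 i), 0); split => //= [a Fa|].
    suff -> : a = a0 by rewrite subrr normr0.
    apply/funext => i; apply: (agree i.+1) => //.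
    by rewrite -e0 exprn_gt0// invr_gt0.
  by rewrite -EFinM lee_fin mulr_ge0 ?exprn_ge0 ?powR_ge0// ltW.
have exk : exists k, b%:R^-1 ^+ k <= e.
  have /andP[q0 q1] := invn_itv R b1.
  have : (b%:R^-1 : R) ^+ k @[k --> \oo] --> (0 : R).
    by apply: cvg_expr; rewrite ger0_norm.
  move=> /cvgr0Pnorm_le /(_ _ e0) [k _ /(_ k (leqnn k))] /=.
  by rewrite ger0_norm ?exprn_ge0// => ?; exists k.
(* Take the least k with b^-k <= e. The bound b^-2 on the diameter forces k >= 2; with k = j + 2,
   minimality gives e < b^-(j+1), so all coded points of [F] share their first j digits. *)
case: (ex_minnP exk) => k ke kmin.
have [j kj] : exists j, k = j.+2.
  have blt : b%:R^-1 < 1 :> R by have /andP[] := invn_itv R b1.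
  have bi : 0 < b%:R^-1 :> R by rewrite invr_gt0.
  case: k ke {kmin} => [|[|j]] ke; last by exists j.
  - by have := le_trans ke eb; rewrite expr0 expr2; nra.
  - by have := le_trans ke eb; rewrite expr1 expr2; nra.
have ej : e < b%:R^-1 ^+ j.+1.
  by rewrite ltNge; apply/negP => /kmin; rewrite kj ltnn.
exists (expansion n (fun i => a0 i), n%:R^-1 ^+ j); split => /=.
- by rewrite exprn_ge0// invr_ge0 ltW.
- move=> a Fa; apply: expansion_agree => // i ij.
  by rewrite (agree j).
(* The radius n^-j equals n^2 n^-k, whence the factor n^2; and b^s <= n gives n^-k <= (b^-k)^s <=
   e^s. *)
- have -> : n%:R^-1 ^+ j = n%:R ^+ 2 * n%:R^-1 ^+ k :> R.
    by rewrite kj [_ ^+ j.+2]exprS [_ ^+ j.+1]exprS; field; rewrite gt_eqF.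
  rewrite -EFinM lee_fin ler_pM2l ?exprn_gt0//.
  apply: le_trans (_ : (b%:R^-1 ^+ k) `^ s <= _); last first.
    by apply: ge0_ler_powR => //;
      rewrite nnegrE ?(ltW e0)// exprn_ge0// invr_ge0 ltW.
  rewrite -(powR_mulrn k (_ : 0 <= b%:R^-1)) ?invr_ge0 ?(ltW b0)//.
  rewrite -powRrM mulrC powRrM powR_mulrn ?powR_ge0//.
  rewrite lerXn2r ?nnegrE ?powR_ge0 ?invr_ge0// ?(ltW n0)//.
  have -> : b%:R^-1 `^ s = (b%:R `^ s)^-1.
    rewrite -(powR_inv1 (ltW b0)) -powRrM mulrC powRrM.
    by rewrite powR_inv1 ?powR_ge0.
  by rewrite lef_pV2// posrE powR_gt0.
Qed.

(** For a cover at scale b^-2, the recoded intervals, of radii r_k, cover [0, 1[. Hence 1 <= sum of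
    2 r_k <= 2 n^2 times the sum of the weights, and the measure is at least 1 / (2 n^2). *)
Lemma hausdorff_measure_expansion_gt0 (R : realType) (b n : nat)
    (dig : nat -> 'I_n -> nat) (s : R) (A : set R) :
  (1 < n)%N -> (forall i, injective (dig i)) ->
  (forall i c, (0 < dig i c < b.-1)%N) -> 0 <= s -> b%:R `^ s <= n%:R ->
  (forall a : nat -> 'I_n, A (expansion b (fun i => dig i (a i)))) ->
  (0 < hausdorff_measure s A)%E.
Proof.
move=> n1 dinj db s0 bs piA.
have b0 : 0 < b%:R :> R.
  by rewrite ltr0n; have := db 0%N (Ordinal (ltnW n1)); lia.
have n0 : 0 < n%:R :> R by rewrite ltr0n; lia.
pose C : R := 2 * n%:R ^+ 2.
have C0 : 0 < C by rewrite mulr_gt0// exprn_gt0.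
apply: (@lt_le_trans _ _ (C^-1)%:E); first by rewrite lte_fin invr_gt0.
apply: le_trans (_ : (hausdorff_premeasure s (b%:R^-1 ^+ 2) A <= _)%E); last first.
  by apply: ereal_sup_ubound; exists (b%:R^-1 ^+ 2) => //=;
    rewrite exprn_gt0// invr_gt0.
apply/ereal_infP => _ [F [dF AF] <-].
have [pr prP] := choice (fun k => expansion_cover n1 dinj db s0 bs (dF k)).
pose I k : set R := [set` `[(pr k).1 - (pr k).2, (pr k).1 + (pr k).2]].
have sub : [set` `[0, 1[] `<=` \bigcup_k I k.
  move=> y; rewrite /= in_itv/= => y01; have [d dn <-] := expansion_surj n1 y01.
  have [k _ Fk] := AF _ (piA (fun i => Ordinal (dn i))).
  exists k => //=; have [_ /(_ _ Fk)/= + _] := prP k.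
  by rewrite /I/= in_itv/= -ler_distl.
have : (lebesgue_measure ([set` `[0%R, 1%R[] : set R) <=
    \sum_(0 <= k <oo) lebesgue_measure (I k))%E.
  by apply: (@measure_sigma_subadditive _ R _ lebesgue_measure _ I) => // *;
    exact: measurable_itv.
rewrite lebesgue_measure_itv/= lte_fin ltr01 oppr0 adde0.
move=> le1; rewrite -[leLHS]mule1 lee_pdivrMl//; apply: (le_trans le1).
rewrite -nneseriesZl => [|k _]; last exact: diam_pow_ge0.
apply: lee_nneseries => [k _ _|k _]; first exact: measure_ge0.
have [r0 _ rF] := prP k.
apply: le_trans (_ : ((2 * (pr k).2)%:E <= _)%E); last first.
  by rewrite EFinM /C EFinM -muleA lee_pmul2l// fin_numE.
rewrite /I lebesgue_measure_itv/= lte_fin.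
case: ifP => _; last by rewrite lee_fin mulr_ge0.
by rewrite -EFinB lee_fin; lra.
Qed.

(** * The Takagi function: bounds and functional equations *)

Lemma dist_int_ge0 (R : realType) (t : R) : 0 <= dist_int t.
Proof. by apply: lb_le_inf => [|_ [k _ <-]]//; exists `|t - 0%:~R|, 0. Qed.

Lemma dist_int_le (R : realType) (t : R) (k : int) : dist_int t <= `|t - k%:~R|.
Proof. by apply: ge_inf; [exists 0 => _ [j _ <-]|exists k]. Qed.

Lemma dist_int_le1 (R : realType) (t : R) : dist_int t <= 1.
Proof.
apply: le_trans (dist_int_le t (Num.floor t)) _.
by have /andP[] := Num.Theory.floor_itv t; rewrite ler_norml intrD; lra.
Qed.

Lemma dist_intDz (R : realType) (t : R) (k : int) :
  dist_int (t + k%:~R) = dist_int t.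
Proof.
congr inf; apply/seteqP; split => _ [j _ <-].
  by exists (j - k) => //; rewrite intrB; congr `|_|; ring.
by exists (j + k) => //; rewrite intrD; congr `|_|; ring.
Qed.

Lemma dist_int01 (R : realType) (t : R) :
  0 <= t <= 1 -> dist_int t = Num.min t (1 - t).
Proof.
move=> /andP[t0 t1]; apply/eqP; rewrite eq_le; apply/andP; split.
  rewrite le_min; apply/andP; split.
    by rewrite -[leRHS]ger0_norm// -[X in `|X|]subr0; exact: (dist_int_le t 0).
  rewrite -[leRHS]ger0_norm ?subr_ge0// distrC; exact: (dist_int_le t 1).
apply: lb_le_inf => [|_ [k _ <-]]; first by exists `|t - 0%:~R|, 0.
rewrite ge_min; have [k0|k1] := leP k 0.
  have : k%:~R <= 0 :> R by rewrite lerz0.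
  by move=> ?; rewrite ler_normr; apply/orP; left; apply/orP; left; lra.
have : 1 <= k%:~R :> R by rewrite ler1z.
by move=> ?; rewrite [X in _ || X]ler_normr; apply/orP; right;
  apply/orP; right; lra.
Qed.

Lemma takagi_term_bound (R : realType) (x : R) n :
  0 <= dist_int (2 ^+ n * x) / 2 ^+ n <= 1 * 2^-1 ^+ n.
Proof.
rewrite divr_ge0 ?dist_int_ge0 ?exprn_ge0//= exprVn.
by rewrite ler_wpM2r ?dist_int_le1// invr_ge0 exprn_ge0.
Qed.

Lemma half_itv (R : realType) : 0 <= (2^-1 : R) < 1.
Proof. by apply/andP; split; lra. Qed.

Lemma is_cvg_takagi (R : realType) (x : R) :
  cvgn (series (fun n => dist_int (2 ^+ n * x) / 2 ^+ n)).
Proof.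
exact: is_cvg_series_geometric_bound (half_itv R) (takagi_term_bound x).
Qed.

(** A crude bound from terms at most 2^-n; it starts the induction in [takagi_expansion_eq]. *)
Lemma takagi_itv (R : realType) (x : R) : 0 <= takagi x <= 2.
Proof.
apply/andP; split.
  apply: limn_series_ge0 => [|n]; first exact: is_cvg_takagi.
  by case/andP: (takagi_term_bound x n).
apply: (le_trans (limn_series_le_geometric (half_itv R) (takagi_term_bound x))).
by have -> : 1 / (1 - 2^-1) = 2 :> R by field.
Qed.

Lemma takagi_recl (R : realType) (x : R) :
  takagi x = dist_int x + takagi (2 * x) / 2.
Proof.
rewrite {1}/takagi limn_series_recl; last exact: is_cvg_takagi.
rewrite expr0 divr1 mul1r -limn_seriesZ; last exact: is_cvg_takagi.
congr (_ + limn (series _)); apply/funext => n.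
by rewrite -mulrA -invfM -exprSr mulrA -exprSr.
Qed.

Lemma takagiD1 (R : realType) (x : R) : takagi (x + 1) = takagi x.
Proof.
congr (limn (series _)); apply/funext => n; congr (_ / _).
have -> : 2 ^+ n * (x + 1) = 2 ^+ n * x + (2 ^+ n : int)%:~R.
  by rewrite mulrDr mulr1 rmorphXn.
exact: dist_intDz.
Qed.

(** Doubling the argument leaves b + t, whose integer part disappears by periodicity. *)
Lemma takagi_bit (R : realType) (b : bool) (t : R) : 0 <= t <= 1 ->
  takagi ((b%:R + t) / 2) = ((if b then 1 - t else t) + takagi t) / 2.
Proof.
move=> /andP[t0 t1]; rewrite takagi_recl dist_int01; last by case: b => /=; lra.
rewrite [2 * _]mulrC divfK ?pnatr_eq0//; case: b => /=.
  rewrite [1 + t]addrC takagiD1 [RHS]mulrDl; congr (_ + _).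
  by rewrite min_r; lra.
by rewrite !add0r [RHS]mulrDl; congr (_ + _); rewrite min_l; lra.
Qed.

(** * Binary words and the Takagi function on dyadic intervals *)

Fixpoint word_val (w : seq bool) : nat :=
  if w is b :: w' then (b * 2 ^ size w' + word_val w')%N else 0%N.

Lemma word_val_lt (w : seq bool) : (word_val w < 2 ^ size w)%N.
Proof. by elim: w => //= b w IH; rewrite expnS; case: b; lia. Qed.

Lemma word_val_negb (w : seq bool) :
  (word_val (map negb w) + word_val w).+1 = (2 ^ size w)%N.
Proof. by elim: w => //= b w IH; rewrite size_map expnS; case: b => /=; lia. Qed.

Lemma word_val_gt0 (w : seq bool) : has id w -> (0 < word_val w)%N.
Proof.
elim: w => //= b w IH /orP[->|/IH]; last by lia.
by rewrite mul1n ltn_addr// expn_gt0.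
Qed.

Lemma word_val_inj (w w' : seq bool) :
  size w = size w' -> word_val w = word_val w' -> w = w'.
Proof.
elim: w w' => [|b w IH] [|b' w']//= [sw].
have := word_val_lt w; have := word_val_lt w'; rewrite sw.
set P := (2 ^ _)%N => h h' e.
have eb : b = b' by move: e; case: b; case: b' => //; lia.
by move: e; rewrite eb => /addnI /(IH _ sw) ->.
Qed.

(** Induction on the word, one leading bit at a time. [s] is the number of zeros minus the number of
    ones, the slope of the partial sum of the Takagi series on this dyadic interval. Complementing
    all bits mirrors the interval about 1/2, which exchanges [t] and [1 - t] in the partial sum. *)
Lemma takagi_word (R : realType) (w : seq bool) :
  let P : R := 2 ^+ size w in
  let s : R := (size w)%:R - 2 * (count id w)%:R in
  exists c : R, forall t, 0 <= t <= 1 ->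
    takagi (((word_val w)%:R + t) / P) = c + s * t / P + takagi t / P /\
    takagi (((word_val (map negb w))%:R + t) / P) =
      c + s * (1 - t) / P + takagi t / P.
Proof.
elim: w => [|b w [c IH]] P s.
  by exists 0 => t _; rewrite /P /s /= !mulr0n add0r expr0 !divr1; split; ring.
rewrite /P /s /= size_map; set Q : R := 2 ^+ size w in IH *.
have Q0 : 0 < Q by rewrite exprn_gt0.
have neg : (word_val (map negb w))%:R + (word_val w)%:R + 1 = Q.
  by rewrite -natrD natr1 word_val_negb natrX.
(* The value of the new partial sum at t = 0: the contribution of the leading bit at the left end of
   the interval, plus the constant of the tail, halved by [takagi_bit]. *)
exists (((if b then Q - (word_val w)%:R else (word_val w)%:R) / Q + c) / 2) => t t01.
have [E1 E2] := IH _ t01.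
have split_bit (v : seq bool) (a : bool) :
    (((a * 2 ^ size w + word_val v)%:R + t) / 2 ^+ (size w).+1 : R) =
    (a%:R + ((word_val v)%:R + t) / Q) / 2.
  rewrite natrD natrM natrX -/Q exprS -/Q.
  by field; rewrite gt_eqF.
have in01 (v : seq bool) : size v = size w -> 0 <= ((word_val v)%:R + t) / Q <= 1.
  move=> sv; have /andP[t0 t1] := t01.
  rewrite divr_ge0 ?addr_ge0 ?(ltW Q0)//= ler_pdivrMr// mul1r.
  have : (word_val v).+1%:R <= Q by rewrite /Q -natrX ler_nat -sv word_val_lt.
  by rewrite -natr1; lra.
rewrite !split_bit !takagi_bit ?in01 ?size_map// E1 E2 exprS -/Q.
have -> : (word_val (map negb w))%:R = Q - 1 - (word_val w)%:R by rewrite -neg; ring.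
rewrite natrD -(natr1 (size w)).
by clear P s; case: b => /=; split; field; rewrite gt_eqF.
Qed.

Definition balanced (m : nat) (w : seq bool) : Prop :=
  size w = m.*2 /\ count id w = m.

Lemma balanced_negb (m : nat) (w : seq bool) :
  balanced m w -> balanced m (map negb w).
Proof.
move=> [sw cw]; split; first by rewrite size_map.
rewrite count_map; have := count_predC id w; rewrite sw cw -addnn => /addnI <-.
exact: eq_count.
Qed.

Lemma balanced_word_val_gt0 (m : nat) (w : seq bool) :
  (0 < m)%N -> balanced m w -> (0 < word_val w)%N.
Proof. by move=> m0 [_ cw]; rewrite word_val_gt0// has_count cw. Qed.

(** The block contains a one, so its value is not 0; its complement is balanced too, so the value is
    not the top digit either. This is the digit range required by [expansion_separated]. *)
Lemma balanced_word_val_itv (m : nat) (w : seq bool) :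
  (0 < m)%N -> balanced m w -> (0 < word_val w < (2 ^ m.*2).-1)%N.
Proof.
move=> m0 bw; rewrite (balanced_word_val_gt0 m0 bw)/=.
have := balanced_word_val_gt0 m0 (balanced_negb bw).
by have := word_val_negb w; rewrite bw.1; lia.
Qed.

(** Equally many zeros and ones make the slope in [takagi_word] vanish, so only the common constant
    remains. *)
Lemma takagi_balanced (R : realType) (m : nat) (w : seq bool) :
  balanced m w -> exists c : R, forall t, 0 <= t <= 1 ->
    let f (v : seq bool) := takagi (((word_val v)%:R + t) / (2 ^ m.*2)%:R) in
    f w = c + takagi t / (2 ^ m.*2)%:R /\
    f (map negb w) = c + takagi t / (2 ^ m.*2)%:R.
Proof.
move=> [sw cw]; have [c cP] := takagi_word R w; exists c => t t01 /=.
have := cP t t01; rewrite sw cw -natrX -mul2n natrM subrr !mul0r addr0.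
by [].
Qed.

(** Removing one digit cancels the common constant and divides the difference of the Takagi values
    by [b]. As these values lie in [0, 2], the difference is at most 2 b^-n for every n. *)
Lemma takagi_expansion_eq (R : realType) (b : nat) (d d' : nat -> nat) :
  (1 < b)%N -> (forall i, (d i < b)%N) -> (forall i, (d' i < b)%N) ->
  (forall i, exists c : R, forall t, 0 <= t <= 1 ->
    takagi (((d i)%:R + t) / b%:R) = c + takagi t / b%:R /\
    takagi (((d' i)%:R + t) / b%:R) = c + takagi t / b%:R) ->
  takagi (expansion b d) = takagi (expansion b d' : R).
Proof.
move=> b1; have b0 : 0 < b%:R :> R by rewrite ltr0n; lia.
have /andP[q0 q1] := invn_itv R b1.
move=> db db' dd'; apply/eqP; rewrite -subr_eq0 -normr_le0.
have cq : 2 * (b%:R^-1 : R) ^+ n @[n --> \oo] --> (2 * 0 : R).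
  by apply: cvgM; [exact: cvg_cst|apply: cvg_expr; rewrite ger0_norm].
rewrite -(mulr0 2) -(cvg_lim _ cq)//; apply: limr_ge; first exact: cvgP cq.
apply: nearW => n; elim: n d d' db db' dd' => [|n IH] d d' db db' dd'.
  have /andP[? ?] := takagi_itv (expansion b d : R).
  have /andP[? ?] := takagi_itv (expansion b d' : R).
  by rewrite expr0 ler_norml; lra.
have [c cP] := dd' 0%N.
rewrite (expansion_recl R b1 db) (expansion_recl R b1 db').
have [-> _] := cP _ (expansion_itv R b1 (fun i => db i.+1)).
have [_ ->] := cP _ (expansion_itv R b1 (fun i => db' i.+1)).
rewrite opprD addrACA subrr add0r -mulrBl normrM (ger0_norm q0) exprSr mulrA.
by rewrite ler_pM2r ?invr_gt0//; apply: IH.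
Qed.

(** * Lower bounds for the dimension: level sets, then [Gamma_H_abs] *)

Lemma hausdorff_dim_expansion_ge (R : realType) (b n : nat)
    (dig : nat -> 'I_n -> nat) (s : R) (A : set R) :
  (1 < n)%N -> (forall i, injective (dig i)) ->
  (forall i c, (0 < dig i c < b.-1)%N) -> b%:R `^ s <= n%:R ->
  (forall a : nat -> 'I_n, A (expansion b (fun i => dig i (a i)))) ->
  (s%:E <= hausdorff_dim A)%E.
Proof.
move=> n1 dinj db bs piA; apply/ereal_infP => _ [t [t0 mt0] <-].
(* An exponent t < s cannot have measure 0, because b^t <= b^s <= n makes the t-measure positive. *)
rewrite lee_fin leNgt; apply/negP => ts.
have b1 : 1 <= b%:R :> R.
  by rewrite ler1n; have := db 0%N (Ordinal (ltnW n1)); lia.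
suff : (0 < hausdorff_measure t A)%E by rewrite mt0 ltxx.
apply: (hausdorff_measure_expansion_gt0 n1 dinj db t0 _ piA).
by apply: le_trans bs; apply: ler_powR => //; exact: ltW.
Qed.

Lemma hausdorff_dim_takagi_level_gt0 (R : realType) (m : nat)
    (w : nat -> seq bool) :
  (0 < m)%N -> (forall i, balanced m (w i)) ->
  (0 < hausdorff_dim (takagi_level
    (takagi (expansion (2 ^ m.*2) (fun i => word_val (w i)) : R))))%E.
Proof.
move=> m0 bw; set B := (2 ^ m.*2)%N.
pose v i (k : 'I_2) := if k == ord0 then w i else map negb (w i).
have bv i k : balanced m (v i k).
  by rewrite /v; case: ifP => _ //; exact: balanced_negb.
have vneq i : word_val (w i) <> word_val (map negb (w i)).
  move=> /word_val_inj; rewrite size_map => /(_ erefl).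
  have := balanced_word_val_gt0 m0 (bw i).
  by case: (w i) => [|[] u].
have vinj i : injective (fun k => word_val (v i k)).
  move=> k k'; rewrite /v; case: eqP => [->|kn]; case: eqP => [->|kn'] //.
  - by move/vneq.
  - by move/esym/vneq.
  - have val1 (l : 'I_2) : l <> ord0 -> l = 1%N :> nat.
      case: l => -[|[|//]] //= l0 l1; by case: l1; apply/val_inj.
    by move=> _; apply/val_inj; rewrite /= !val1.
have m20 : 0 < m.*2%:R :> R by rewrite ltr0n double_gt0.
(* The exponent 1 / (2m) solves B^s = 2, the number of choices per block. *)
apply: (@lt_le_trans _ _ ((m.*2%:R : R)^-1)%:E); first by rewrite lte_fin invr_gt0.
have B1 : (1 < B)%N by rewrite /B -{1}(expn0 2) ltn_exp2l// double_gt0.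
have ltB u : balanced m u -> (word_val u < B)%N.
  by move=> [su _]; rewrite /B -su word_val_lt.
apply: (@hausdorff_dim_expansion_ge R B 2 (fun i k => word_val (v i k))) => //.
- by move=> i c; exact: balanced_word_val_itv.
- by rewrite /B natrX -powR_mulrn// -powRrM mulfV ?gt_eqF// powRr1.
- move=> a; have ltv i := ltB _ (bv i (a i)); have ltw i := ltB _ (bw i).
  split; first by rewrite in_itv/=; exact: expansion_itv.
  apply: takagi_expansion_eq => // i; have [c cP] := takagi_balanced R (bw i).
  exists c => t t01; have [E1 E2] := cP t t01.
  by rewrite /v; case: ifP.
Qed.

(** The indicator word of a subset: distinct m-element subsets give distinct balanced words, and
    [card_draws] counts these subsets. *)
Definition set_word (k : nat) (A : {set 'I_k}) : seq bool :=
  [seq i \in A | i <- enum 'I_k].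

Lemma balanced_set_word (m : nat) (A : {set 'I_m.*2}) :
  #|A| = m -> balanced m (set_word A).
Proof.
move=> cA; split; first by rewrite size_map size_enum_ord.
rewrite count_map -[RHS]cA cardE -size_filter; congr size.
by rewrite enumT; apply: eq_filter.
Qed.

Lemma set_word_inj (k : nat) : injective (@set_word k).
Proof.
move=> A A' /eq_in_map AA'; apply/setP => i; apply: AA'.
by rewrite mem_enum.
Qed.

(** The induction rests on the recurrence (m + 1) C(2m+2, m+1) = 2 (2m + 1) C(2m, m), together with
    2m + 2 <= 2m + 3. *)
Lemma central_binomial_ge (m : nat) : (4 ^ m <= m.*2.+1 * 'C(m.*2, m))%N.
Proof.
elim: m => // m IH.
have E : (m.+1 * 'C(m.+1.*2, m.+1) = 2 * (m.*2.+1 * 'C(m.*2, m)))%N.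
  rewrite doubleS -mul_bin_diag.
  have -> : 'C(m.*2.+1, m) = 'C(m.*2.+1, m.+1).
    by rewrite -(@bin_sub _ m); [congr 'C(_, _)|]; rewrite -mul2n; lia.
  by rewrite (mul_bin_diag m.*2.+1 m) -doubleS -mul2n mulnA.
rewrite expnS doubleS; move: E; rewrite doubleS.
by nia.
Qed.

Lemma exists_central_binomial_ge (R : realType) (s : R) : s < 1 ->
  exists2 m, (0 < m)%N & (2 ^ m.*2)%:R `^ s <= 'C(m.*2, m)%:R.
Proof.
(* Since (4^m)^s p^(2m) = 4^m, [central_binomial_ge] reduces the claim to 2m + 1 <= p^(2m), which
   holds for large m because p > 1. *)
move=> s1; pose p : R := 2 `^ (1 - s); pose h := p - 1.
have h0 : 0 < h.
  have -> : h = p - 1 `^ (1 - s) by rewrite powR1.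
  by rewrite subr_gt0; apply: gt0_ltr_powR; rewrite ?nnegrE; lra.
have bern n : 1 + n%:R * h <= p ^+ n.
  elim: n => [|n IH]; first by rewrite expr0 mul0r addr0.
  have n0 : 0 <= n%:R :> R by [].
  rewrite exprS -natr1; apply: le_trans (_ : p * (1 + n%:R * h) <= _).
    have pE : p = 1 + h by rewrite addrC subrK.
    have nh : 0 <= n%:R * (h * h) by rewrite mulr_ge0// ltW// mulr_gt0.
    by rewrite pE -subr_ge0; move: nh; congr (_ <= _); ring.
  by rewrite ler_pM2l// powR_gt0.
(* With m h^2 >= 2, squaring Bernoulli's inequality gives p^(2m) >= (1 + m h)^2 >= 1 + 2m. *)
pose m := (Num.truncn (2 / h ^+ 2)).+1.
have mh : 2 <= m%:R * h ^+ 2.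
  rewrite -ler_pdivrMr ?exprn_gt0//; apply/ltW.
  by rewrite Num.Theory.truncnS_gt.
exists m => //.
have q : (m.*2.+1)%:R <= p ^+ m.*2.
  rewrite -addnn exprD -expr2.
  apply: le_trans (_ : (1 + m%:R * h) ^+ 2 <= _).
    rewrite -addn1 !natrD.
    have m0 : 0 <= m%:R :> R by [].
    have : m%:R * 2 <= m%:R * (m%:R * h ^+ 2) by apply: ler_wpM2l.
    by nra.
  have m0 : 0 <= m%:R * h by rewrite mulr_ge0// ltW.
  by rewrite lerXn2r ?nnegrE// ?addr_ge0// exprn_ge0// powR_ge0.
set Bs := _ `^ s.
have BsE : Bs * p ^+ m.*2 = (4 ^ m)%:R.
  rewrite /Bs /p natrX -powR_mulrn// -powRrM [_ * s]mulrC
    powRrM powR_mulrn ?powR_ge0//.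
  rewrite -exprMn -powRD ?pnatr_eq0 ?implybT//.
  by rewrite addrC subrK powRr1// -natrX -mul2n expnM.
have M0 : 0 < m.*2.+1%:R :> R by [].
rewrite -(ler_pM2l M0) -natrM.
apply: le_trans (_ : (4 ^ m)%:R <= _); last by rewrite ler_nat central_binomial_ge.
by rewrite -BsE mulrC ler_wpM2l// powR_ge0.
Qed.

Lemma hausdorff_dim_Gamma_H_abs_ge1 (R : realType) :
  (1 <= hausdorff_dim (Gamma_H_abs R))%E.
Proof.
apply/lee_addgt0Pr => e e0; rewrite -leeBlDr//.
have [m m0 ms] := @exists_central_binomial_ge R (1 - e) ltac:(lra).
pose S := [set A : {set 'I_m.*2} | #|A| == m]%SET.
have cS : #|S| = 'C(m.*2, m) by rewrite card_draws card_ord.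
have SP (k : 'I_#|S|) : balanced m (set_word (enum_val k)).
  by apply: balanced_set_word; have := enum_valP k; rewrite inE => /eqP.
apply: (@hausdorff_dim_expansion_ge R (2 ^ m.*2) #|S|
  (fun=> fun k => word_val (set_word (enum_val k)))).
(* Pascal's rule splits the central binomial coefficient into two positive terms, so it exceeds
   1. *)
- rewrite cS; case: m m0 {ms S cS SP} => // m _.
  rewrite doubleS binS; have : (0 < 'C(m.*2.+1, m))%N by rewrite bin_gt0; lia.
  by have : (0 < 'C(m.*2.+1, m.+1))%N by [rewrite bin_gt0; lia]; lia.
- move=> _ k k' /word_val_inj; rewrite !size_map => /(_ erefl).
  by move=> /set_word_inj/enum_val_inj.
- by move=> _ c; exact: balanced_word_val_itv.
- by rewrite cS.
- move=> a; split; last exact: hausdorff_dim_takagi_level_gt0.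
  rewrite in_itv/=; apply: expansion_itv.
    by rewrite -{1}(expn0 2) ltn_exp2l// double_gt0.
  by move=> i; have := balanced_word_val_itv m0 (SP (a i)); lia.
Qed.

(** * Upper bound for the dimension *)

Lemma diam_itv_le (R : realType) (a b : R) :
  a <= b -> (diam [set` `[a, b]] <= (b - a)%:E)%E.
Proof.
move=> ab; apply/ereal_supP => _ [->|[[x y] [/= + +] <-]].
  by rewrite lee_fin subr_ge0.
rewrite !in_itv/= lee_fin ler_norml => /andP[ax xb] /andP[ay yb].
by apply/andP; split; lra.
Qed.

(** Covering [0, 1] by K intervals of length 1/K costs K K^-(1+e) = K^-e, which tends to 0, so every
    exponent 1 + e gives measure 0. *)
Lemma hausdorff_dim_le1 (R : realType) (A : set R) :
  A `<=` [set` `[0, 1]] -> (hausdorff_dim A <= 1)%E.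
Proof.
move=> A01; apply/lee_addgt0Pr => e e0.
apply: ereal_inf_lbound; exists (1 + e) => //; split; first by lra.
apply/eqP; rewrite eq_le; apply/andP; split; last first.
  apply: le_trans (_ : (hausdorff_premeasure (1 + e) 1 A <= _)%E).
    apply/ereal_infP => _ [F _ <-]; apply: nneseries_ge0 => k _ _.
    exact: diam_pow_ge0.
  by apply: ereal_sup_ubound; exists 1 => //=.
apply/ereal_supP => _ [delta /= d0 <-]; apply/lee_addgt0Pr => r r0; rewrite add0e.
(* The second entry ensures 1/K <= delta, the third K^-e <= r. *)
pose K := maxn 1 (maxn (Num.truncn delta^-1).+1 (Num.truncn (r^-1 `^ e^-1)).+1).
have K0 : 0 < K%:R :> R by rewrite ltr0n !leq_max.
have Kd : K%:R^-1 <= delta.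
  rewrite -[delta]invrK lef_pV2 ?posrE ?invr_gt0//.
  apply/ltW/(lt_le_trans (Num.Theory.truncnS_gt _)).
  by rewrite ler_nat !leq_max leqnn ?orbT.
have Kr : K%:R `^ (- e) <= r.
  have Ke : r^-1 `^ e^-1 <= K%:R.
    apply/ltW/(lt_le_trans (Num.Theory.truncnS_gt _)).
    by rewrite ler_nat !leq_max leqnn ?orbT.
  rewrite powRN -[r]invrK lef_pV2 ?posrE ?invr_gt0 ?powR_gt0//.
  have ri : 0 <= r^-1 by rewrite invr_ge0 ltW.
  have -> : r^-1 = (r^-1 `^ e^-1) `^ e.
    by rewrite -powRrM mulVf ?gt_eqF// powRr1.
  by apply: ge0_ler_powR; rewrite ?nnegrE ?powR_ge0 ?(ltW e0) ?(ltW K0).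
(* The empty sets from index K on have weight 0 by the convention in [diam_pow]. *)
pose F k : set R :=
  if (k < K)%N then [set` `[k%:R / K%:R, k.+1%:R / K%:R]] else set0.
have dF k : (k < K)%N -> (diam (F k) <= (K%:R^-1)%:E)%E.
  move=> kK; rewrite /F kK; apply: le_trans (diam_itv_le _) _.
    by rewrite ler_pM2r ?invr_gt0// ler_nat.
  by rewrite lee_fin -mulrBl -natr1 addrAC subrr add0r mul1r.
apply: (@le_trans _ _ (\sum_(0 <= k <oo) diam_pow (1 + e) (F k))%E).
  apply: ereal_inf_lbound; exists F => //; split=> [k|x Ax].
    have [kK|kK] := ltnP k K; first by rewrite (le_trans (dF k kK))// lee_fin.
    rewrite /F ltnNge kK/=; apply/ereal_supP => _ [->|[[? ?] [[]]]].
    by rewrite lee_fin ltW.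
  have := A01 _ Ax; rewrite /= in_itv/= => /andP[x0 x1].
  (* At x = 1 the index truncn (x K) would be K, out of range; this point belongs to the last
     interval. *)
  have [->|xn1] := eqVneq x 1.
    exists K.-1 => //; rewrite /F ltn_predL -(ltr0n R) K0 /= in_itv/=.
    rewrite prednK -?(ltr0n R)// mulfV ?gt_eqF// lexx andbT.
    by rewrite ler_pdivrMr// mul1r ler_nat leq_pred.
  have xK : 0 <= x * K%:R by rewrite mulr_ge0// ltW.
  have /andP[k1 k2] := Num.Theory.truncn_itv xK.
  exists (Num.truncn (x * K%:R)) => //; rewrite /F.
  have -> : (Num.truncn (x * K%:R) < K)%N.
    by rewrite -(ltr_nat R) (le_lt_trans k1)// gtr_pMl// lt_neqAle xn1.
  by rewrite /= in_itv/= ler_pdivrMr// k1 ler_pdivlMr// ltW.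
rewrite (nneseries_split 0 K); last by move=> k _; exact: diam_pow_ge0.
rewrite add0n [X in (_ + X)%E]eseries0 ?adde0; last first.
  by move=> k Kk _; rewrite /F ltnNge Kk /diam_pow eqxx.
apply: (@le_trans _ _ (\sum_(0 <= k < K) (K%:R^-1 `^ (1 + e))%:E)%E).
  rewrite !big_mkord; apply: lee_sum => k _; rewrite /diam_pow; case: ifP => _.
    by rewrite lee_fin powR_ge0.
  rewrite -poweR_EFin; apply: gt0_ler_poweR.
  - by rewrite addr_ge0// ltW.
  - by rewrite in_itv/= diam_ge0 leey.
  - by rewrite in_itv/= lee_fin invr_ge0 ltW// leey.
  - exact: dF.
rewrite sumEFin lee_fin sumr_const_nat subn0; apply: le_trans Kr.
rewrite -[leLHS]mulr_natl powRD ?invr_eq0 ?(gt_eqF K0) ?implybT//.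
rewrite powRr1 ?invr_ge0 ?(ltW K0)// mulrA mulfV ?gt_eqF// mul1r.
by rewrite powRN -powR_inv1 ?(ltW K0)// -powRrM mulN1r powRN.
Qed.

Theorem theorem1p4 (R : realType) : hausdorff_dim (Gamma_H_abs R) = 1%E.
Proof.
apply/eqP; rewrite eq_le hausdorff_dim_Gamma_H_abs_ge1 andbT.
by apply: hausdorff_dim_le1 => x [].
Qed.
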